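(* Let $X$ be a complex Banach space with a $1$-unconditional Schauder basis $(e_j)_{j\ge1}$ and let $K\subset X$ be bounded and solid. For every $n\in\mathbb N_0$, every $P\in\mathcal P({}^nX)$ and every degree-$n$ multi-index $\gamma$, $$\|S_\gamma P\|_K\le (n+1)\|P\|_K .$$ Consequently, the constant $c_{K,n}$ satisfies $$c_{K,n}\le n+1 .$$
   Context: A Schauder basis $(e_j)$ of $X$ is $1$-unconditional if $\|\sum_j\lambda_jx_je_j\|\le\|\sum_jx_je_j\|$ whenever $\sum_j x_je_j\in X$ and $|\lambda_j|\le1$ for all $j$. A set $A\subset X$ is solid (with respect to $(e_j)$) if $x=\sum_jx_je_j\in A$, $y=\sum_jy_je_j\in X$ and $|y_j|\le|x_j|$ for all $j$ imply $y\in A$. $\mathcal P({}^nX)$ is the space of continuous scalar-valued $n$-homogeneous polynomials on $X$, with $\mathcal P({}^0X)=\mathbb C$. $\|f\|_K=\sup_{x\in K}|f(x)|$. Let $(e_j^* )$ be the coefficient functionals of $(e_j)$, $\pi_Nx=\sum_{j=1}^Ne_j^*(x)e_j$, $\pi_0=0$. Multi-indices are finitely supported sequences $\alpha=(\alpha_j)_{j\ge1}$ in $\mathbb N_0$; $|\alpha|=\sum_j\alpha_j$ is the degree; $\operatorname{len}(\alpha)=\max\operatorname{supp}(\alpha)$, $\operatorname{len}(0)=0$; $e^{*\alpha}(x)=\prod_je_j^*(x)^{\alpha_j}$. Square order: for multi-indices of the same degree, $\alpha\prec\beta$ if either $\operatorname{len}(\alpha)<\operatorname{len}(\beta)$, or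 $\operatorname{len}(\alpha)=\operatorname{len}(\beta)$ and $\alpha_j<\beta_j$ for $j=\max\{i:\alpha_i\ne\beta_i\}$. $(P_{n,m})_{m\ge1}$ denotes the degree-$n$ monomials listed in the square order. For $P\in\mathcal P({}^nX)$ and a degree-$n$ multi-index $\gamma$ with $k=\operatorname{len}(\gamma)$, write uniquely $P\circ\pi_k=\sum_{|\beta|=n,\ \operatorname{len}(\beta)\le k}a_\beta(P)e^{*\beta}$; the square partial sum ending at $e^{*\gamma}$ is $S_\gamma P=\sum_{|\beta|=n,\ \beta\preceq\gamma}a_\beta(P)e^{*\beta}$. $c_{K,n}\in[0,\infty]$ is the least constant $C$ such that $\left\|\sum_{m=1}^sa_mP_{n,m}\right\|_K\le C\left\|\sum_{m=1}^ta_mP_{n,m}\right\|_K$ whenever $s<t$ and $a_1,\dots,a_t\in\mathbb C$. *)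

(* Defs.v *)
From HB Require Import structures.
From mathcomp Require Import all_boot all_order all_algebra.
From mathcomp Require Import finmap complex.
From mathcomp Require Import all_classical all_reals all_analysis.

Set Implicit Arguments.
Unset Strict Implicit.
Unset Printing Implicit Defensive.

Import Order.TTheory GRing.Theory Num.Theory.
Import numFieldNormedType.Exports.

Local Open Scope classical_set_scope.
Local Open Scope ring_scope.
Local Open Scope complex_scope.

(* Basis vectors, coordinates and multi-index entries are numbered from 0. *)

Notation multi := {fsfun nat -> nat with 0%N}.

Definition mdeg (b : multi) : nat := (\sum_(j <- finsupp b) b j)%N.

(* With 0-based indices, len is one more than the largest element of the
   support. *)
Definition mlen (b : multi) : nat := (\max_(j <- finsupp b) j.+1)%N.

(* The largest index at which a and b differ (0 if a = b). *)
Definition lastdiff (a b : multi) : nat :=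
  (\max_(j <- (finsupp a `|` finsupp b)%fset | a j != b j) j)%N.

Definition square_lt (a b : multi) : bool :=
  ((mlen a < mlen b) ||
   (mlen a == mlen b) && (a (lastdiff a b) < b (lastdiff a b)))%N.

Definition square_le (a b : multi) : bool := (a == b) || square_lt a b.

Definition multis (n k : nat) : set multi :=
  [set b | mdeg b = n /\ (mlen b <= k)%N].

Definition square_seq (n k : nat) : seq multi :=
  sort square_le (fset_set (multis n k)).

(* The multi-index of P_{n,m} for m >= 1.  The multi-indices of length at most
   m form an initial segment of the square order, and for n > 0 this segment
   has at least m elements; see square_idxP below. *)
Definition square_idx (n m : nat) : multi :=
  nth [fsfun] (square_seq n m) m.-1.

Section Basis.
Variables (R : realType) (X : completeNormedModType R[i]) (e : nat -> X).

Definition expands (a : nat -> R[i]) (x : X) : Prop :=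
  (fun N => \sum_(j < N) a j *: e j) @ \oo --> x.

Definition schauder_basis : Prop :=
  forall x : X, exists! a : nat -> R[i], expands a x.

Definition coef (j : nat) (x : X) : R[i] :=
  xget (fun=> 0) [set a | expands a x] j.

Definition unconditional1 : Prop :=
  forall (x : X) (l : nat -> R[i]), (forall j, `|l j| <= 1) ->
    exists y, expands (fun j => l j * coef j x) y /\ `|y| <= `|x|.

Definition solid (A : set X) : Prop :=
  forall x y : X, A x -> (forall j, `|coef j y| <= `|coef j x|) -> A y.

Definition trunc (N : nat) (x : X) : X := \sum_(j < N) coef j x *: e j.

Definition monom (b : multi) (x : X) : R[i] :=
  \prod_(j <- finsupp b) coef j x ^+ b j.

Definition multilinear (n : nat) (A : ('I_n -> X) -> R[i]) : Prop :=
  forall (v : 'I_n -> X) (i : 'I_n), scalar (fun x => A (dfwith v i x)).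

(* R[i]^o is R[i] with the topology of the modulus. *)
Definition cont_hpoly (n : nat) (P : X -> R[i]) : Prop :=
  continuous (P : X -> R[i]^o) /\
  exists A : ('I_n -> X) -> R[i],
    multilinear A /\ forall x, P x = A (fun=> x).

Definition is_pcoefs (n k : nat) (P : X -> R[i]) (a : multi -> R[i]) : Prop :=
  (forall b, ~ multis n k b -> a b = 0) /\
  forall x, P (trunc k x) = \sum_(b \in multis n k) a b * monom b x.

(* These coefficients exist and are unique: pcoefP, is_pcoefs_unique. *)
Definition pcoef (n k : nat) (P : X -> R[i]) : multi -> R[i] :=
  xget (fun=> 0) [set a | is_pcoefs n k P a].

Definition square_psum (n : nat) (P : X -> R[i]) (g : multi) (x : X) : R[i] :=
  \sum_(b \in [set b | mdeg b = n /\ square_le b g])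
    pcoef n (mlen g) P b * monom b x.

(* Normc.normc is the modulus with values in R.  Adding 0 only matters for
   empty K, where the supremum of nonnegative numbers is taken to be 0. *)
Definition supnorm (K : set X) (f : X -> R[i]) : \bar R :=
  ereal_sup ([set 0%E] `|` [set (Normc.normc (f x))%:E | x in K]).

Definition mlincomb (n s : nat) (a : nat -> R[i]) (x : X) : R[i] :=
  \sum_(1 <= m < s.+1) a m * monom (square_idx n m) x.

(* There is only one monomial of degree 0, whence the condition on t. *)
Definition basis_const (K : set X) (n : nat) : \bar R :=
  ereal_inf [set C : \bar R | (0 <= C)%E /\
    forall (s t : nat) (a : nat -> R[i]),
      (s < t)%N -> (n = 0 -> t <= 1)%N ->
      (supnorm K (mlincomb n s a) <= C * supnorm K (mlincomb n t a))%E].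

End Basis.

Lemma ltn_mlen (b : multi) j : b j != 0%N -> (j < mlen b)%N.
Proof. by rewrite -mem_finsupp => bj; apply: (leq_bigmax_seq _ bj). Qed.

Lemma mlen_leP (b : multi) k :
  reflect (forall j, (k <= j)%N -> b j = 0%N) (mlen b <= k)%N.
Proof.
apply: (iffP idP) => [lek j kj|h].
  by apply/eqP/negPn/negP => /ltn_mlen; rewrite ltnNge (leq_trans lek).
apply/bigmax_leqP_seq => j; rewrite mem_finsupp => bj _.
by rewrite ltnNge; apply/negP => /h; apply/eqP.
Qed.

Lemma big_finsupp (T : Type) (idx : T) (op : Monoid.com_law idx) (b : multi)
    (F : nat -> T) k : (mlen b <= k)%N -> (forall j, b j = 0%N -> F j = idx) ->
  \big[op/idx]_(j <- finsupp b) F j = \big[op/idx]_(j < k) F j.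
Proof.
move=> lek F0; rewrite -(big_mkord xpredT) [RHS](bigID [in finsupp b])/=.
rewrite [X in op _ X]big1; last by move=> j; rewrite mem_finsupp negbK => /eqP/F0.
rewrite Monoid.mulm1 -[RHS]big_filter; apply/perm_big/uniq_perm.
- exact: fset_uniq.
- exact/filter_uniq/iota_uniq.
move=> j; rewrite mem_filter mem_iota subn0 add0n /= mem_finsupp andbC.
case: eqVneq => [|/ltn_mlen/leq_trans/(_ lek)->] //=; by rewrite ?andbF.
Qed.

Lemma mdegE (b : multi) k : (mlen b <= k)%N -> mdeg b = (\sum_(j < k) b j)%N.
Proof. by move=> lek; apply: big_finsupp. Qed.

Lemma multiP (a b : multi) k : (mlen a <= k)%N -> (mlen b <= k)%N ->
  (forall j, (j < k)%N -> a j = b j) -> a = b.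
Proof.
move=> /mlen_leP ha /mlen_leP hb h; apply/fsfunP => j.
by case: (ltnP j k) => [/h//|kj]; rewrite ha ?hb.
Qed.

Lemma finite_multis n k : finite_set (multis n k).
Proof.
pose f (b : multi) : {ffun 'I_k -> 'I_n.+1} := [ffun i : 'I_k => inord (b i) : 'I_n.+1].
apply: (@sub_finite_set _ _ ((fun g => xget [fsfun] [set b | multis n k b /\ f b = g])
  @` [set: {ffun 'I_k -> 'I_n.+1}])); last exact/finite_image/finite_finset.
move=> b nkb; exists (f b) => //=.
have [[dc lc] fc] : [set b' | multis n k b' /\ f b' = f b]
    (xget [fsfun] [set b' | multis n k b' /\ f b' = f b]).
  by apply: (xgetPex [fsfun]); exists b.
have [db lb] := nkb.
have small (a : multi) : mdeg a = n -> (mlen a <= k)%N -> forall i : 'I_k, (a i < n.+1)%N.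
  by move=> <- /mdegE-> i; rewrite ltnS (bigD1 i)//= leq_addr.
apply: (@multiP _ _ k lc lb) => j jk.
have := congr1 (fun g : {ffun 'I_k -> 'I_n.+1} => g (Ordinal jk) : nat) fc.
by rewrite !ffunE !inordK//; exact: (small _ _ _ (Ordinal jk)).
Qed.

Lemma lastdiffP (a b : multi) : a != b ->
  a (lastdiff a b) != b (lastdiff a b) /\
  forall j, (lastdiff a b < j)%N -> a j = b j.
Proof.
move=> ab; set r := enum_fset (finsupp a `|` finsupp b)%fset.
have rP j : a j != b j -> j \in r.
  rewrite /r in_fsetU !mem_finsupp; case: (a j =P 0%N) => //= -> h.
  by rewrite eq_sym.
have [j0 hj0] : exists j, a j != b j.
  apply: contrapT => /forallNP h; move/eqP: ab; apply; apply/fsfunP => j.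
  by apply/eqP/negPn/negP/h.
split; last first.
  move=> j; rewrite ltnNge => h; apply/eqP/negPn/negP => abj; move/negP: h; apply.
  exact: (leq_bigmax_seq _ (rP _ abj) abj).
have [j abj ->] : exists2 j, a j != b j & lastdiff a b = j.
  rewrite /lastdiff -/r; have : has (fun j => a j != b j) r.
    by apply/hasP; exists j0 => //; apply: rP.
  elim: r {rP} => // j s IHs /=; rewrite big_cons.
  case: ifPn => [abj _|_ /IHs//].
  case: (boolP (has (fun j => a j != b j) s)) => [/IHs[i abi ->]|ns].
    by rewrite /maxn; case: ifP => _; [exists i|exists j].
  exists j => //; rewrite big1_seq ?maxn0// => i /andP[abi si].
  by case/negP: ns; apply/hasP; exists i.
by [].
Qed.

Lemma square_ltP (a b : multi) :
  reflect ((mlen a < mlen b)%N \/ mlen a = mlen b /\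
    exists2 j, (a j < b j)%N & forall i, (j < i)%N -> a i = b i) (square_lt a b).
Proof.
apply: (iffP orP) => -[->|]; [by left| |by left|].
  case/andP=> /eqP ab lt; right; split => //; exists (lastdiff a b) => //.
  by apply: (lastdiffP _).2; apply: contraTneq lt => ->; rewrite ltnn.
case=> ab [j abj h]; right; rewrite ab eqxx /=.
have /lastdiffP[ne eq] : a != b by apply: contraTneq abj => ->; rewrite ltnn.
case: (ltngtP (lastdiff a b) j) => [/eq e|/h e|->//]; first by rewrite e ltnn in abj.
by rewrite e eqxx in ne.
Qed.

Lemma square_lt_irr : irreflexive square_lt.
Proof. by move=> a; rewrite /square_lt !ltnn andbF. Qed.

Lemma square_lt_trans : transitive square_lt.
Proof.
move=> b a c /square_ltP[ab|[ab [i abi hi]]] /square_ltP[bc|[bc [j bcj hj]]];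
  apply/square_ltP.
- by left; apply: ltn_trans bc.
- by left; rewrite -bc.
- by left; rewrite ab.
right; split; first by rewrite ab.
case: (ltngtP i j) => ij.
- exists j; first by rewrite hi.
  by move=> m jm; rewrite hi ?hj// (ltn_trans ij).
- exists i; first by rewrite -hj.
  by move=> m im; rewrite hi ?hj// (ltn_trans ij).
- exists i; first by rewrite (ltn_trans abi)// ij.
  by move=> m im; rewrite hi ?hj// -ij.
Qed.

Lemma square_lt_total (a b : multi) : [|| a == b, square_lt a b | square_lt b a].
Proof.
case: eqVneq => //= ab; have [ne h] := lastdiffP ab.
case: (ltngtP (mlen a) (mlen b)) => l.
- by apply/orP; left; apply/square_ltP; left.
- by apply/orP; right; apply/square_ltP; left.
case: (ltngtP (a (lastdiff a b)) (b (lastdiff a b))) ne => // lt _.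
- by apply/orP; left; apply/square_ltP; right; split=> //; exists (lastdiff a b).
- apply/orP; right; apply/square_ltP; right; split=> //.
  by exists (lastdiff a b) => // i /h.
Qed.

Lemma square_le_total : total square_le.
Proof.
move=> a b; have := square_lt_total a b; rewrite /square_le.
by case: eqVneq => //=; case/orP => ->; rewrite ?orbT.
Qed.

Lemma mem_square_seq n k b :
  (b \in square_seq n k) = (mdeg b == n) && (mlen b <= k)%N.
Proof.
rewrite mem_sort in_fset_set; last exact: finite_multis.
by apply/idP/andP => [/set_mem[-> ->]//|[/eqP db lb]]; apply: mem_set.
Qed.

Lemma square_seq_sorted n k : sorted square_lt (square_seq n k).
Proof.
have : sorted square_le (square_seq n k) by apply/sort_sorted/square_le_total.
have : uniq (square_seq n k) by rewrite sort_uniq fset_uniq.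
elim: (square_seq n k) => //= a [//|b s] IHs /andP[ha hu] /= /andP[hab hp].
apply/andP; split; last exact: IHs.
by move: hab ha; rewrite /square_le inE; case: eqP.
Qed.

(* The segments of the square order given by the length are nested. *)
Lemma square_seqS n k : exists s, square_seq n k.+1 = square_seq n k ++ s.
Proof.
exists [seq b <- square_seq n k.+1 | (k < mlen b)%N].
apply: (irr_sorted_eq square_lt_trans square_lt_irr).
- exact: square_seq_sorted.
- rewrite (sorted_pairwise square_lt_trans) pairwise_cat.
  rewrite -!(sorted_pairwise square_lt_trans) square_seq_sorted.
  rewrite (sorted_filter square_lt_trans) ?square_seq_sorted// !andbT.
  apply/allrelP => a b; rewrite mem_filter !mem_square_seq.
  move=> /andP[_ la] /andP[lb _]; apply/square_ltP; left.
  exact: leq_ltn_trans lb.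
move=> b; rewrite mem_cat mem_filter !mem_square_seq andbCA -andb_orr.
by congr (_ && _); case: (leqP (mlen b) k) => //= /leqW->.
Qed.

Lemma square_seq_prefix n k m :
  exists s, square_seq n (k + m) = square_seq n k ++ s.
Proof.
elim: m => [|m [s e]]; first by exists [::]; rewrite addn0 cats0.
have [s' e'] := square_seqS n (k + m).
by exists (s ++ s'); rewrite addnS e' e catA.
Qed.

Lemma size_square_seq n k : (0 < n)%N -> (k <= size (square_seq n k))%N.
Proof.
move=> n0; elim: k => // k IHk; have [s e] := square_seqS n k.
rewrite e size_cat; suff : (0 < size s)%N by move=> s0; rewrite -[k.+1]addn1; apply: leq_add.
pose d : multi := [fsfun [fsfun] with k |-> n].
have dE j : d j = if j == k then n else 0%N by rewrite fsfun_withE fsfun0E.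
have ld : mlen d = k.+1.
  apply/eqP; rewrite eqn_leq ltn_mlen ?dE ?eqxx ?andbT -?lt0n//.
  by apply/mlen_leP => j kj; rewrite dE gtn_eqF.
have : d \in square_seq n k.+1.
  rewrite mem_square_seq ld leqnn andbT (mdegE (k := k.+1)) ?ld//.
  rewrite big_ord_recr /= dE eqxx big1// => i _.
  by rewrite dE ltn_eqF.
by rewrite e mem_cat mem_square_seq ld ltnn andbF; case: s {e}.
Qed.

(* For n > 0 the sequence square_idx n 1, square_idx n 2, ... lists the
   multi-indices of degree n increasingly in the square order. *)
Lemma square_idx_nth n m k : (0 < n)%N -> (m < size (square_seq n k))%N ->
  square_idx n m.+1 = nth [fsfun] (square_seq n k) m.
Proof.
move=> n0 mk; rewrite /square_idx /=.
have [s e] := square_seq_prefix n k m.+1.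
have [s' e'] := square_seq_prefix n m.+1 k.
move: e; rewrite addnC e' => /(congr1 (fun s => nth [fsfun] s m)).
by rewrite !nth_cat mk size_square_seq.
Qed.

Lemma square_idxP n : (0 < n)%N ->
  [/\ forall m, (0 < m)%N -> mdeg (square_idx n m) = n,
      forall m p, (0 < m < p)%N -> square_lt (square_idx n m) (square_idx n p) &
      forall b, mdeg b = n -> exists2 m, (0 < m)%N & square_idx n m = b].
Proof.
move=> n0; have sz := size_square_seq _ n0; split.
- case=> // m _; rewrite (square_idx_nth n0 (sz m.+1)).
  by have := mem_nth [fsfun] (sz m.+1); rewrite mem_square_seq => /andP[/eqP].
- case=> // m [//|p] /=; rewrite ltnS => mp.
  have mp' : (m < size (square_seq n p.+1))%N by apply: leq_trans (sz _); apply: ltnW.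
  rewrite (square_idx_nth n0 mp') (square_idx_nth n0 (sz p.+1)).
  by apply: (sorted_ltn_nth square_lt_trans _ (square_seq_sorted n p.+1)); rewrite ?inE.
move=> b db; have bs : b \in square_seq n (mlen b) by rewrite mem_square_seq db eqxx leqnn.
exists (index b (square_seq n (mlen b))).+1 => //.
by rewrite (@square_idx_nth _ _ (mlen b)) ?index_mem// nth_index.
Qed.

Section PolyCoefs.
Variables (R : realType) (X : completeNormedModType R[i]) (e : nat -> X).
Hypothesis basis_e : schauder_basis e.
Variable k : nat.

Local Notation coef := (coef e).
Local Notation monom := (monom e).
Local Notation trunc := (trunc e).

Lemma coefE a x : expands e a x -> coef^~ x = a.
Proof.
move=> ax; have [a' [_ u]] := basis_e x.
have /= := xgetI (fun=> 0) (ax : [set a | expands e a x] a).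
by move=> /u; rewrite -(u a ax) => ->.
Qed.

Lemma coef_fin (c : nat -> R[i]) i :
  coef i (\sum_(j < k) c j *: e j) = if (i < k)%N then c i else 0.
Proof.
suff /coefE/(congr1 (@^~ i)) -> : expands e (fun i => if (i < k)%N then c i else 0)
  (\sum_(j < k) c j *: e j) by [].
apply: cvg_near_cst; near=> N.
have kN : (k <= N)%N by near: N; exact: nbhs_infty_ge.
rewrite (big_ord_widen _ (fun j => c j *: e j) kN) [RHS]big_mkcond/=.
by apply: eq_bigr => j _; case: ifP => //; rewrite scale0r.
Unshelve. all: by end_near. Qed.

Lemma monomE b x m : (mlen b <= m)%N ->
  monom b x = \prod_(j < m) coef j x ^+ b j.
Proof. by move=> lb; apply: big_finsupp lb _ => j ->. Qed.

Let incr j (b : multi) : multi := [fsfun b with j |-> (b j).+1].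

Let multis_incr n (j : 'I_k) b : multis n k b -> multis n.+1 k (incr j b).
Proof.
move=> [db lb]; have lb' : (mlen (incr j b) <= k)%N.
  apply/mlen_leP => i ki; rewrite fsfun_withE gtn_eqF ?(mlen_leP _ _ lb)//.
  exact: leq_trans ki.
split=> //; rewrite -db (mdegE lb') (mdegE lb) (bigD1 j)//= [in RHS](bigD1 j)//=.
rewrite fsfun_with addSn; congr (_ + _).+1; apply: eq_bigr => i ij.
by rewrite fsfun_withE val_eqE (negbTE ij).
Qed.

Let monom_incr n (j : 'I_k) b x : multis n k b ->
  monom (incr j b) x = coef j x * monom b x.
Proof.
move=> nb; have [_ lb] := nb; have [_ lb'] := multis_incr j nb.
rewrite (monomE _ lb') (monomE _ lb) (bigD1 j)//= [in RHS](bigD1 j)//=.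
rewrite fsfun_with exprS mulrA; congr (_ * _); apply: eq_bigr => i ij.
by rewrite fsfun_withE val_eqE (negbTE ij).
Qed.

Let spoly n (f : X -> R[i]) := exists2 r : seq (R[i] * multi),
  (forall p, p \in r -> multis n k p.2) &
  forall x, f x = \sum_(p <- r) p.1 * monom p.2 x.

Let spolyD n f g : spoly n f -> spoly n g -> spoly n (fun x => f x + g x).
Proof.
move=> [r rn rE] [s sn sE]; exists (r ++ s) => [p|x].
  by rewrite mem_cat => /orP[/rn|/sn].
by rewrite big_cat rE sE.
Qed.

Let spoly_sum n m (F : 'I_m -> X -> R[i]) :
  (forall j, spoly n (F j)) -> spoly n (fun x => \sum_(j < m) F j x).
Proof.
move=> FP; elim: (index_enum _) => [|j s IHs].
  by exists [::] => // x; rewrite !big_nil.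
case: (spolyD (FP j) IHs) => r rn rE; exists r => // x.
by rewrite big_cons rE.
Qed.

Let spolyM n (j : 'I_k) f : spoly n f -> spoly n.+1 (fun x => coef j x * f x).
Proof.
move=> [r rn rE]; exists [seq (p.1, incr j p.2) | p <- r] => [_ /mapP[p pr ->]|x].
  exact/multis_incr/rn.
rewrite big_map rE mulr_sumr big_seq [RHS]big_seq; apply: eq_bigr => p pr /=.
by rewrite (monom_incr _ _ (rn _ pr)) mulrCA.
Qed.

Let scalar_sum (f : X -> R[i]) m (c : 'I_m -> R[i]) (u : 'I_m -> X) :
  scalar f -> f (\sum_(j < m) c j *: u j) = \sum_(j < m) c j * f (u j).
Proof.
move=> fP; elim/big_rec2 : _ => [|j y x _ <-]; last by rewrite fP.
by have := fP (-1) 0 0; rewrite scaler0 addr0 mulN1r addNr.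
Qed.

Let spoly_trunc n (A : ('I_n -> X) -> R[i]) : multilinear A ->
  spoly n (fun x => A (fun=> trunc k x)).
Proof.
move=> AP.
suff H m : (m <= n)%N -> forall v : 'I_n -> X,
    spoly m (fun x => A (fun i => if (i < m)%N then trunc k x else v i)).
  have [r rn rE] := H n (leqnn n) (fun=> 0); exists r => // x; rewrite -rE.
  by congr A; apply/funext => i; rewrite ltn_ord.
elim: m => [_ v|m IHm mn v].
  exists [:: (A v, [fsfun])] => [p|x].
    rewrite inE => /eqP->; split => /=; last by apply/mlen_leP => j _; rewrite fsfun0E.
    by rewrite /mdeg finsupp0 big_seq_fset0.
  by rewrite big_seq1/= /Defs.monom finsupp0 big_seq_fset0 mulr1.
pose i0 := Ordinal mn.
have /spoly_sum[r rn rE] : forall j : 'I_k, spoly m.+1 (fun x => coef j x *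
    A (fun i => if (i < m)%N then trunc k x else dfwith v i0 (e j) i)).
  by move=> j; apply/spolyM/IHm/ltnW.
exists r => // x; rewrite -rE /=.
pose w (i : 'I_n) : X := if (i < m)%N then trunc k x else v i.
have -> : (fun i : 'I_n => if (i < m.+1)%N then trunc k x else v i) =
    dfwith w i0 (trunc k x).
  apply/funext => i; case: dfwithP => [|j ij]; first by rewrite ltnSn.
  rewrite /w ltnS leq_eqVlt; case: eqP => //= e0.
  by case/eqP: ij; apply/val_inj.
apply: etrans (scalar_sum (fun j : 'I_k => coef j x) (fun j => e j) (AP w i0)) _.
apply: eq_bigr => j _.
congr (_ * A _); apply/funext => i; rewrite /w.
case: dfwithP => [|l il]; first by rewrite ltnn dfwithin.
by rewrite dfwithout.
Qed.

Lemma is_pcoefs_exists n P : cont_hpoly n P ->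
  exists a : multi -> R[i], is_pcoefs e n k P a.
Proof.
move=> [_ [A [AP PA]]]; have [r rn rE] := spoly_trunc AP.
exists (fun b => \sum_(p <- r | p.2 == b) p.1); split.
  move=> b nb; rewrite big1_seq// => p /andP[/eqP pb pr].
  by case: nb; rewrite -pb; exact: rn.
move=> x; rewrite PA rE fsbig_finite; last exact: finite_multis.
under [RHS]eq_bigr do rewrite big_mkcond mulr_suml.
rewrite exchange_big /= big_seq [RHS]big_seq; apply: eq_bigr => p pr.
rewrite (bigD1_seq p.2) ?fset_uniq//=; last first.
  by rewrite in_fset_set; [exact/mem_set/rn|exact: finite_multis].
rewrite eqxx big1 ?addr0// => b.
by rewrite eq_sym => /negbTE->; rewrite mul0r.
Qed.

(* A polynomial function in c_0, ..., c_(k-1) determines its coefficients. *)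
Let vanish (r : seq multi) (a : multi -> R[i]) m : uniq r ->
    {in r &, forall b b' : multi, (forall j, (j < m)%N -> b j = b' j) -> b = b'} ->
    (forall c : nat -> R[i], \sum_(b <- r) a b * \prod_(j < m) c j ^+ b j = 0) ->
  {in r, forall b, a b = 0}.
Proof.
elim: m r => [|m IHm] r ur ri r0 b br.
  have := r0 (fun=> 0); rewrite (bigD1_seq b)//= big_ord0 mulr1 big1_seq ?addr0//.
  by move=> b' /andP[/eqP bb' b'r]; case: bb'; apply: ri.
suff : {in [seq b' : multi <- r | b' m == b m], forall b', a b' = 0}.
  by apply; rewrite mem_filter eqxx.
apply: IHm => [||c].
- exact: filter_uniq.
- move=> b1 b2; rewrite !mem_filter => /andP[/eqP b1m b1r] /andP[/eqP b2m b2r] h.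
  apply: ri => // j; rewrite ltnS leq_eqVlt => /orP[/eqP->|/h//].
  by rewrite b1m.
- pose q : {poly R[i]} :=
    \sum_(b <- r) (a b * \prod_(j < m) c j ^+ b j) *: 'X^(b m).
  suff : q = 0.
    move=> /(congr1 (fun p : {poly _} => p`_(b m))).
    rewrite coef0 coef_sum => {2}<-; rewrite big_filter big_mkcond.
    apply: eq_bigr => b' _; rewrite coefZ coefXn eq_sym.
    by case: eqP => _; rewrite ?mulr1 ?mulr0.
  apply/eqP/negPn/negP => q0.
  suff : (size q < size q)%N by rewrite ltnn.
  rewrite -[X in (X < _)%N](size_iota 0) -(size_map (GRing.natmul (1 : R[i]))).
  apply: max_poly_roots => //.
    apply/allP => _ /mapP[i _ ->]; apply/rootP.
    rewrite horner_sum -[RHS](r0 (fun j => if j == m then i%:R else c j)).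
    apply: eq_bigr => b' _; rewrite hornerZ hornerXn big_ord_recr/= eqxx mulrA.
    congr (_ * _ * _); apply: eq_bigr => j _.
    by rewrite ltn_eqF.
  by rewrite map_inj_uniq ?iota_uniq//; exact: mulrIn (oner_neq0 _).
Qed.

Lemma is_pcoefs_unique n P a a' :
  is_pcoefs e n k P a -> is_pcoefs e n k P a' -> a = a'.
Proof.
move=> [a0 aE] [a0' aE']; apply/funext => b.
have fin := finite_multis n k.
have [nb|nb] := pselect (multis n k b); last by rewrite a0 ?a0'.
apply/eqP; rewrite -subr_eq0; apply/eqP.
apply: (@vanish (fset_set (multis n k)) (fun b => a b - a' b) k).
- exact: fset_uniq.
- move=> b1 b2; rewrite !in_fset_set// => /set_mem[_ l1] /set_mem[_ l2].
  exact: multiP.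
- move=> c; pose x := \sum_(j < k) c j *: e j.
  have cx (j : 'I_k) : coef j x = c j by rewrite coef_fin ltn_ord.
  have := aE x; rewrite aE' !fsbig_finite// => /eqP.
  rewrite eq_sym -subr_eq0 -sumrB => /eqP; rewrite big_seq => {2}<-.
  rewrite big_seq; apply: eq_bigr => b'; rewrite in_fset_set// => /set_mem[_ l].
  rewrite -mulrBl (monomE _ l); congr (_ * _); apply: eq_bigr => j _.
  by rewrite cx.
by rewrite in_fset_set//; exact: mem_set.
Qed.

Lemma pcoefP n P : cont_hpoly n P -> is_pcoefs e n k P (pcoef e n k P).
Proof. by move=> /is_pcoefs_exists; exact: xgetPex. Qed.

End PolyCoefs.

(* Main.v *)
Require Import Defs.
From HB Require Import structures.
From mathcomp Require Import all_boot all_order all_algebra.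
From mathcomp Require Import finmap complex.
From mathcomp Require Import cyclic separable cyclotomic.
From mathcomp Require Import all_classical all_reals all_analysis.
From mathcomp Require Import ring.

Set Implicit Arguments.
Unset Strict Implicit.
Unset Printing Implicit Defensive.

Import Order.TTheory GRing.Theory Num.Theory.
Import numFieldNormedType.Exports.

Local Open Scope classical_set_scope.
Local Open Scope ring_scope.
Local Open Scope complex_scope.

(** Among multi-indices of one degree, the square order compares two of them
    at the last index where they differ: whichever is longer has the larger
    entry there.  Hence the multi-indices b strictly below g split into
    disjoint classes C_(j,t), for t < g_j, where C_(j,t) consists of the b
    with b_i = g_i for all i > j and b_j = t.  There are |g| = n such classes,
    and with the singleton class of g itself n + 1 of them.

    Each class is cut out by prescribing the exponents of some coordinates.
    Keeping only the monomials in which the j-th exponent is t is a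
    contraction for the supremum norm on K: it is the average of
    w^(-t) f(x with its j-th coordinate multiplied by w) over sufficiently
    many roots of unity w, and the rotated points exist by 1-unconditionality
    and stay in K by solidity ([exponent_projection_le]).  Prescribing the
    exponents one coordinate at a time, from the last to the first, bounds the
    part of f on each class by the norm of f.  An induction on the number of
    free coordinates ([square_prefix_le]) adds up these n + 1 contributions.

    This argument concerns finite linear combinations of monomials only, so it
    bounds c_(K,n) directly.  For a polynomial P it is applied to P o pi_k with
    k = len(g), and the norm of P o pi_k on K is at most that of P, because
    pi_k maps the solid set K into itself ([solid_trunc]). *)

(** * Averages over roots of unity *)

(** In characteristic zero X^N - 1 is separable, so it has N distinct roots,
    and a finite group of roots of unity in a field is cyclic. *)
Lemma numClosed_prim_root (C : numClosedFieldType) (N : nat) :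
  (0 < N)%N -> exists z : C, N.-primitive_root z.
Proof.
move=> N0; pose p : {poly C} := 'X^N - 1.
have [r Dp] := closed_field_poly_normal p.
rewrite (monicP _) ?monicXnsubC// scale1r in Dp.
have rN : all N.-unity_root r by apply/allP => z; rewrite -root_prod_XsubC -Dp.
have sz : (N < (size r).+1)%N by rewrite -(size_prod_XsubC r id) -Dp size_XnsubC.
have [|z _ zN] := hasP (has_prim_root N0 rN _ sz); last by exists z.
by rewrite -separable_prod_XsubC -Dp separable_Xn_sub_1// pnatr_eq0 -lt0n.
Qed.

Lemma norm_prim_root (C : numDomainType) (N : nat) (z : C) :
  N.-primitive_root z -> `|z| = 1.
Proof.
move=> zN; have N0 := prim_order_gt0 zN; apply/eqP.
by rewrite -(pexpr_eq1 N0)// -normrX prim_expr_order// normr1.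
Qed.

(** Discrete Fourier orthogonality; it lets an average over rotations pick out
    the exponent t among all exponents below N. *)
Lemma sum_expr_prim_root (C : fieldType) (N : nat) (z : C) (s t : nat) :
  N.-primitive_root z -> (s < N)%N -> (t < N)%N ->
  \sum_(k < N) (z ^+ k) ^+ s / (z ^+ k) ^+ t = if s == t then N%:R else 0.
Proof.
move=> zN sN tN; have N0 := prim_order_gt0 zN.
have z0 : z != 0.
  apply/eqP => z0; have := prim_expr_order zN.
  by rewrite z0 expr0n gtn_eqF// => /eqP; rewrite eq_sym oner_eq0.
under eq_bigr do rewrite -!exprM !(mulnC (nat_of_ord _)) !exprM -expr_div_n.
have st : (z ^+ s / z ^+ t == 1) = (s == t).
  by rewrite -subr_eq0 -(mulfV (expf_neq0 t z0)) -mulrBl mulf_eq0 invr_eq0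
    (negbTE (expf_neq0 t z0)) orbF subr_eq0 (eq_prim_root_expr zN) !modn_small.
case: ifPn => [st1|nst].
  move: st1; rewrite -st => /eqP->.
  by under eq_bigr do rewrite expr1n; rewrite sumr_const card_ord.
have : (z ^+ s / z ^+ t) ^+ N - 1 = 0.
  by rewrite expr_div_n !(exprAC z _ N) (prim_expr_order zN) !expr1n divr1 subrr.
by rewrite subrX1 => /eqP; rewrite mulf_eq0 subr_eq0 st (negbTE nst)/= => /eqP.
Qed.

(** * The square order as a colexicographic order *)

(** The entry b m is positive and a agrees with b beyond m, so a cannot be
    longer than b: comparing lengths never contradicts comparing the last
    differing entries. *)
Lemma square_lt_colex (a b : multi) (m : nat) :
  (forall i, (m < i)%N -> a i = b i) -> (a m < b m)%N -> square_lt a b.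
Proof.
move=> ab lt; have : (mlen a <= mlen b)%N.
  apply/mlen_leP => j; case: (leqP j m) => [jm bj|mj bj].
    by move: lt; rewrite (mlen_leP b (mlen b) (leqnn _) m (leq_trans bj jm)).
  by rewrite ab//; exact: (mlen_leP b (mlen b) (leqnn _)).
rewrite leq_eqVlt => /orP[/eqP|] l; apply/square_ltP; last by left.
by right; split => //; exists m.
Qed.

(** One step of reading a and b from the top index downwards. *)
Lemma square_le_colex (a b : multi) (m : nat) :
  (forall i, (m < i)%N -> a i = b i) ->
  square_le a b = (a m < b m)%N || (a m == b m) && square_le a b.
Proof.
move=> ab; case: ltngtP => //= lt.
  by rewrite /square_le (square_lt_colex ab)// orbT.
have ba : square_lt b a by apply: square_lt_colex lt => i /ab.
apply/negbTE; apply/negP => /orP[/eqP E|/square_lt_trans/(_ ba)].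
  by rewrite E ltnn in lt.
by rewrite square_lt_irr.
Qed.

(** * Coefficient projections on a solid set *)

Section Projections.
Variables (R : realType) (X : completeNormedModType R[i]) (e : nat -> X).
Variable K : set X.
Hypotheses (basis_e : schauder_basis e) (uncond_e : unconditional1 e).
Hypothesis solid_K : solid e K.

Local Notation coef := (coef e).
Local Notation monom := (monom e).

Lemma solid_multiplier (l : nat -> R[i]) (x : X) :
  (forall j, `|l j| <= 1) -> K x ->
  exists2 y, K y & forall j, coef j y = l j * coef j x.
Proof.
move=> l1 Kx; have [y [/(Defs.coefE basis_e) cy _]] := uncond_e x l1.
have {}cy j : coef j y = l j * coef j x by rewrite -[LHS]/((coef^~ y) j) cy.
exists y => //; apply: solid_K Kx _ => j.
by rewrite cy normrM ler_piMl.
Qed.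

Lemma solid_trunc (k : nat) (x : X) : K x -> K (trunc e k x).
Proof.
move=> Kx; apply: solid_K Kx _ => j; rewrite coef_fin//.
by case: ifP => //; rewrite normr0.
Qed.

Lemma monom_rotate (b : multi) (j : nat) (z : R[i]) (x y : X) :
  (forall i, coef i y = (if i == j then z else 1) * coef i x) ->
  monom b y = z ^+ b j * monom b x.
Proof.
move=> cy; pose m := maxn (mlen b) j.+1; have jm : (j < m)%N by exact: leq_maxr.
have bm : (mlen b <= m)%N by exact: leq_maxl.
rewrite !(monomE e _ bm).
under eq_bigr do rewrite cy exprMn.
rewrite big_split/=; congr (_ * _).
rewrite (bigD1 (Ordinal jm))//= eqxx big1 ?mulr1// => i ij.
have /negbTE-> : nat_of_ord i != j by rewrite -val_eqE in ij.
by rewrite expr1n.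
Qed.

Variables (I : eqType) (a : I -> R[i]) (b : I -> multi).

Definition mono_sum (r : seq I) (x : X) : R[i] :=
  \sum_(i <- r) a i * monom (b i) x.

(** The projection is an average of unimodular multiples of rotations of the
    j-th coordinate, and K is stable under these rotations. *)
Lemma exponent_projection_le (M : R[i]) (j t : nat) (r : seq I) :
  (forall x, K x -> `|mono_sum r x| <= M) ->
  forall x, K x -> `|mono_sum [seq i <- r | b i j == t] x| <= M.
Proof.
move=> rM x Kx.
(* More roots than the largest exponent are needed, so that the exponents and t
   are distinguished modulo N. *)
pose N := (maxn t (\max_(i <- r) b i j)).+1.
have bN i : i \in r -> (b i j < N)%N.
  by move=> ir; rewrite ltnS leq_max (leq_bigmax_seq _ ir) ?orbT.
have tN : (t < N)%N by rewrite ltnS leq_maxl.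
have [z zN] := @numClosed_prim_root R[i] N isT.
have z1 k : `|z ^+ k| = 1 by rewrite normrX (norm_prim_root zN) expr1n.
have rot (k : 'I_N) : { y | K y & forall i, coef i y = (if i == j then z ^+ k else 1) * coef i x}.
  apply/cid2; have [|y Ky cy] := @solid_multiplier (fun i => if i == j then z ^+ k else 1) x _ Kx.
    by move=> i; case: ifP; rewrite ?z1 ?normr1.
  by exists y.
pose y k := s2val (rot k).
have Ky k : K (y k) by rewrite /y; case: (rot k).
have cy k : forall i, coef i (y k) = (if i == j then z ^+ k else 1) * coef i x.
  by rewrite /y; case: (rot k).
have N0 : 0 < N%:R :> R[i] by rewrite ltr0n.
rewrite -(ler_pM2l N0) -[X in X * `|_|](ger0_norm (ltW N0)) -normrM.
suff -> : N%:R * mono_sum [seq i <- r | b i j == t] x =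
    \sum_(k < N) ((z ^+ k) ^+ t)^-1 * mono_sum r (y k).
  apply: le_trans (ler_norm_sum _ _ _) _.
  rewrite mulrC -[N in leRHS]card_ord mulr_natr -sumr_const ler_sum// => k _.
  by rewrite normrM normfV normrX z1 expr1n invr1 mul1r rM.
rewrite /mono_sum; under [RHS]eq_bigr do rewrite mulr_sumr.
rewrite exchange_big/= big_filter big_mkcond mulr_sumr/=.
rewrite big_seq [RHS]big_seq; apply: eq_bigr => i ir.
transitivity (\sum_(k < N) (z ^+ k) ^+ b i j / (z ^+ k) ^+ t *
    (a i * monom (b i) x)).
  rewrite -mulr_suml (sum_expr_prim_root zN (bN _ ir) tN).
  by case: ifP; rewrite ?mul0r ?mulr0.
by apply: eq_bigr => k _; rewrite (monom_rotate _ (cy k)); ring.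
Qed.

(** When all entries beyond m already agree with g, the entry at m decides,
    unless it equals that of g. *)
Lemma square_prefix_split (m : nat) (g : multi) (r : seq I) (x : X) :
  (forall i, i \in r -> forall j, (m < j)%N -> b i j = g j) ->
  mono_sum [seq i <- r | square_le (b i) g] x =
  \sum_(t < g m) mono_sum [seq i <- r | b i m == t] x +
  mono_sum [seq i <- [seq i <- r | b i m == g m] | square_le (b i) g] x.
Proof.
move=> rg; rewrite /mono_sum -filter_predI !big_filter.
rewrite [LHS]big_mkcond [X in _ = _ + X]big_mkcond/=.
under [X in _ = X + _]eq_bigr do rewrite big_filter big_mkcond.
rewrite exchange_big/= -big_split/= big_seq [RHS]big_seq.
apply: eq_bigr => i ir; rewrite (square_le_colex (rg i ir)) -big_mkcond/=.
under eq_bigl do rewrite eq_sym.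
rewrite (big_ord1_eq _ (fun=> a i * monom (b i) x)).
by case: ltngtP => //=; rewrite ?add0r ?addr0 ?andbT ?andbF// => _; case: square_le.
Qed.

(** The coordinates below m are the free ones.  Freeing the coordinate m adds
    g m classes, one for each value of the exponent below g m, while the class
    with exponent g m is left to the induction; the final 1 counts g itself. *)
Lemma square_prefix_le (M : R[i]) (m : nat) (g : multi) (r : seq I) :
  (forall i, i \in r -> forall j, (m <= j)%N -> b i j = g j) ->
  (forall x, K x -> `|mono_sum r x| <= M) ->
  forall x, K x -> `|mono_sum [seq i <- r | square_le (b i) g] x| <=
    (\sum_(j < m) g j)%N.+1%:R * M.
Proof.
elim: m r => [|m IHm] r rg rM x Kx.
  rewrite big_ord0 mul1r; have /all_filterP-> : all (fun i => square_le (b i) g) r.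
    by apply/allP => i ir; apply/orP; left; apply/eqP/fsfunP => j; exact: rg.
  exact: rM.
rewrite (square_prefix_split (m := m))//.
rewrite big_ord_recr/= -addSn addnC natrD mulrDl.
apply: le_trans (ler_normD _ _) _; apply: lerD.
  apply: le_trans (ler_norm_sum _ _ _) _.
  rewrite -[g m in leRHS]card_ord mulrC mulr_natr -sumr_const ler_sum// => t _.
  exact: exponent_projection_le.
apply: IHm Kx => [i|]; last exact: exponent_projection_le.
rewrite mem_filter => /andP[/eqP gm ir] j.
by rewrite leq_eqVlt => /orP[/eqP<-//|]; exact: rg.
Qed.

End Projections.

(** * Supremum norms *)

Section SupNorm.
Variables (R : realType) (X : completeNormedModType R[i]) (K : set X).

Lemma supnorm_ge0 (f : X -> R[i]) : (0 <= supnorm K f)%E.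
Proof. by apply: ereal_sup_ubound; left. Qed.

Lemma supnorm_leP (f : X -> R[i]) (M : R) : 0 <= M ->
  (supnorm K f <= M%:E)%E <-> forall x, K x -> `|f x| <= M%:C.
Proof.
move=> M0; split => [fM x Kx|fM].
  rewrite lecR -lee_fin; apply: le_trans fM; apply: ereal_sup_ubound.
  by right; exists x.
apply: ge_ereal_sup => _ [->|[x Kx <-]]; rewrite lee_fin//.
by rewrite -lecR; exact: fM.
Qed.

(** An infinite norm of g makes the bound trivial; otherwise that norm is itself
    an admissible M.  The factor is written c.+1 so that it is nonzero, because
    0 * +oo would be 0. *)
Lemma supnorm_le_mul (c : nat) (f g : X -> R[i]) :
  (forall M : R[i], (forall x, K x -> `|g x| <= M) ->
     forall x, K x -> `|f x| <= c.+1%:R * M) ->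
  (supnorm K f <= c.+1%:R%:E * supnorm K g)%E.
Proof.
move=> fg; have := supnorm_ge0 g.
case E : (supnorm K g) => [M| |]// M0; last by rewrite gt0_muley ?leey ?lte_fin.
rewrite lee_fin in M0; rewrite -EFinM; apply/supnorm_leP; first exact: mulr_ge0.
have gM : forall x, K x -> `|g x| <= M%:C by apply/supnorm_leP => //; rewrite E.
move=> x Kx; rewrite rmorphM/= rmorph_nat; exact: fg Kx.
Qed.

End SupNorm.

(** * Initial segments of the square order *)

Section SquarePrefix.
Variables (R : realType) (X : completeNormedModType R[i]) (e : nat -> X).
Variable K : set X.
Hypotheses (basis_e : schauder_basis e) (uncond_e : unconditional1 e).
Hypothesis solid_K : solid e K.

(** A finite family of monomials involves finitely many coordinates, so beyond
    some m all exponents vanish, as do the entries of g: the induction on the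
    free coordinates can start there. *)
Lemma square_prefix_supnorm (I : eqType) (a : I -> R[i]) (b : I -> multi)
    (g : multi) (r : seq I) :
  (supnorm K (mono_sum e a b [seq i <- r | square_le (b i) g]) <=
   (mdeg g).+1%:R%:E * supnorm K (mono_sum e a b r))%E.
Proof.
pose m := maxn (mlen g) (\max_(i <- r) mlen (b i)).
have gm : (mlen g <= m)%N by exact: leq_maxl.
apply: supnorm_le_mul => M rM x Kx; rewrite (mdegE gm).
apply: (square_prefix_le basis_e uncond_e solid_K) => // i ir j mj.
have bm : (mlen (b i) <= m)%N.
  by rewrite leq_max; apply/orP; right; exact: leq_bigmax_seq ir _.
by rewrite (mlen_leP _ _ gm)// (mlen_leP _ _ bm).
Qed.

Lemma supnorm_trunc_le (P : X -> R[i]) (k : nat) :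
  (supnorm K (fun x => P (trunc e k x)) <= supnorm K P)%E.
Proof.
apply: ge_ereal_sup => _ [->|[x Kx <-]]; first exact: supnorm_ge0.
apply: ereal_sup_ubound; right; exists (trunc e k x) => //.
exact: solid_trunc.
Qed.

Lemma square_psumE (n : nat) (P : X -> R[i]) (g : multi) :
  square_psum e n P g =
  mono_sum e (pcoef e n (mlen g) P) id
    [seq b <- fset_set (multis n (mlen g)) | square_le b g].
Proof.
have fin := finite_multis n (mlen g).
apply/funext => x; rewrite /square_psum /mono_sum; apply: fsbig_fwiden.
- move=> b [db bg]; rewrite /= mem_filter bg in_fset_set//; apply/mem_set.
  split=> //; case/orP: bg => [/eqP->//|/square_ltP[/ltnW//|[->//]]].
- exact/filter_uniq/fset_uniq.
- move=> b [/=]; rewrite mem_filter in_fset_set// => /andP[bg /set_mem[db _]] [].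
  by split.
Qed.

Lemma square_psum_supnorm (n : nat) (P : X -> R[i]) (g : multi) :
  cont_hpoly n P -> mdeg g = n ->
  (supnorm K (square_psum e n P g) <= n.+1%:R%:E * supnorm K P)%E.
Proof.
move=> Pn dg; have [_ PE] := pcoefP e (mlen g) Pn.
rewrite square_psumE -[n in n.+1]dg.
apply: le_trans (square_prefix_supnorm _ _ _ _) _.
rewrite lee_pmul2l//; apply: le_trans (supnorm_trunc_le P (mlen g)).
have -> // : mono_sum e (pcoef e n (mlen g) P) id
    (fset_set (multis n (mlen g))) = fun x => P (trunc e (mlen g) x).
by apply/funext => x; rewrite PE fsbig_finite//; exact: finite_multis.
Qed.

(** The first s monomials of the list are those up to the s-th in the square
    order, so the shorter sum is a square prefix of the longer one. *)
Lemma mlincomb_supnorm (n s t : nat) (a : nat -> R[i]) :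
  (s < t)%N -> (n = 0 -> t <= 1)%N ->
  (supnorm K (mlincomb e n s a) <= n.+1%:R%:E * supnorm K (mlincomb e n t a))%E.
Proof.
move=> st nt.
(* P_(n,0) does not exist, and the empty sum has norm 0. *)
case: (posnP s) => [->|s0].
  apply: (@le_trans _ _ 0%E); last by rewrite mule_ge0 ?supnorm_ge0.
  by apply/supnorm_leP => // x _; rewrite /mlincomb big_geq// normr0.
have n0 : (0 < n)%N.
  by rewrite lt0n; apply/eqP => /nt; rewrite leqNgt (leq_ltn_trans s0 st).
have [idx_deg idx_lt _] := square_idxP n0.
have idxE i : (0 < i)%N -> square_le (square_idx n i) (square_idx n s) = (i <= s)%N.
  move=> i0; rewrite /square_le; case: ltngtP => [lt|lt|->]; last by rewrite eqxx.
    by rewrite idx_lt ?i0// orbT.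
  have si : square_lt (square_idx n s) (square_idx n i) by rewrite idx_lt ?s0.
  apply/negbTE; apply/negP => /orP[/eqP E|/square_lt_trans/(_ si)].
    by rewrite E square_lt_irr in si.
  by rewrite square_lt_irr.
have -> : mlincomb e n s a = mono_sum e a (square_idx n)
    [seq i <- index_iota 1 t.+1 | square_le (square_idx n i) (square_idx n s)].
  apply/funext => x; rewrite /mlincomb /mono_sum big_filter.
  rewrite (big_nat_widen _ _ t.+1)//; last by rewrite ltnS ltnW.
  rewrite big_nat_cond [RHS]big_nat_cond; apply: eq_bigl => i.
  by case: (posnP i) => [->//|i0]; rewrite idxE.
have := square_prefix_supnorm a (square_idx n) (square_idx n s) (index_iota 1 t.+1).
by rewrite idx_deg.
Qed.

End SquarePrefix.

Theorem proposition4p2 (R : realType) (X : completeNormedModType R[i])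
    (e : nat -> X) (K : set X) (n : nat)
    (basis_e : schauder_basis e) (uncond_e : unconditional1 e)
    (bounded_K : bounded_set K) (solid_K : solid e K) :
  (forall (P : X -> R[i]) (g : multi), cont_hpoly n P -> mdeg g = n ->
     (supnorm K (square_psum e n P g) <= n.+1%:R%:E * supnorm K P)%E) /\
  (basis_const e K n <= n.+1%:R%:E)%E.
Proof.
split=> [P g|]; first exact: square_psum_supnorm.
apply: ereal_inf_lbound; split=> [|s t a]; first by rewrite lee_fin.
exact: mlincomb_supnorm.
Qed.
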